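(* $\mathcal{MR}\!\left(\frac{I_9}{9},\frac{I_9}{9}\right)=12=\lfloor\sqrt{9^2+9^2-1}\rfloor$.
   Context: $\mathbb{M}_n$ is the algebra of complex $n\times n$ matrices with identity $I_n$. A linear map $\Phi:\mathbb{M}_{d_1}\to\mathbb{M}_{d_2}$ is completely positive (CP) if and only if $\Phi(X)=\sum_{j=1}^r V_j^*XV_j$ for some complex $d_1\times d_2$ matrices $V_j$; the smallest possible $r$ is the Choi-rank $CR(\Phi)$. $\Phi^*:\mathbb{M}_{d_2}\to\mathbb{M}_{d_1}$ is the dual map defined by $\mathrm{tr}(\Phi(X)^*Y)=\mathrm{tr}(X^*\Phi^*(Y))$. For $A_1\in\mathbb{M}_{d_1}$, $A_2\in\mathbb{M}_{d_2}$, let $\mathcal{CP}[\mathbb{M}_{d_1},\mathbb{M}_{d_2};A_1,A_2]$ be the convex set of all CP maps $\Phi:\mathbb{M}_{d_1}\to\mathbb{M}_{d_2}$ with $\Phi(I_{d_1})=A_2$ and $\Phi^*(I_{d_2})=A_1$, and let $\mathcal{MR}(A_1,A_2)=\sup\{CR(\Phi):\Phi\text{ is an extreme point of }\mathcal{CP}[\mathbb{M}_{d_1},\mathbb{M}_{d_2};A_1,A_2]\}$. $\lfloor a\rfloor$ is the largest integer not exceeding $a$. Here $d_1=d_2=9$. *)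

(* Defs.v *)
From HB Require Import structures.
From mathcomp Require Import all_boot all_order all_algebra.
From mathcomp Require Import all_classical all_reals ereal.
From mathcomp Require Export complex.
Set Implicit Arguments.
Unset Strict Implicit.
Unset Printing Implicit Defensive.
Import Order.TTheory GRing.Theory Num.Theory.
Local Open Scope classical_set_scope.
Local Open Scope ring_scope.

(* The complex numbers are R[i] for R : realType; linear maps between matrix
   algebras are the C-linear 'Hom's, so that convex combinations of maps and
   equality of maps are those of the vector space 'Hom. *)
Notation linmap R d1 d2 := 'Hom('M[R[i]]_d1, 'M[R[i]]_d2).

Definition adjmx (R : realType) (m n : nat) (A : 'M[R[i]]_(m, n)) :
  'M[R[i]]_(n, m) := map_mx Num.conj A^T.

Definition kraus (R : realType) (d1 d2 : nat) (Phi : linmap R d1 d2)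
    (r : nat) : Prop :=
  exists V : 'I_r -> 'M[R[i]]_(d1, d2),
    forall X : 'M[R[i]]_d1, Phi X = \sum_(j < r) adjmx (V j) *m X *m V j.

Definition completely_positive (R : realType) (d1 d2 : nat)
    (Phi : linmap R d1 d2) : Prop := exists r : nat, kraus Phi r.

(* [choi_rank Phi] is the least r such that [kraus Phi r]; the default 0 is
   only used when Phi is not completely positive (see [choi_rankP]). *)
Definition choi_rank (R : realType) (d1 d2 : nat) (Phi : linmap R d1 d2) :
    nat :=
  xget 0%N [set r | kraus Phi r /\ forall s : nat, kraus Phi s -> (r <= s)%N].

Lemma choi_rankP (R : realType) (d1 d2 : nat) (Phi : linmap R d1 d2) :
  completely_positive Phi ->
  kraus Phi (choi_rank Phi) /\
  forall s : nat, kraus Phi s -> (choi_rank Phi <= s)%N.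
Proof.
move=> cpPhi; apply: (@xgetPex _ 0%N
  [set r | kraus Phi r /\ forall s : nat, kraus Phi s -> (r <= s)%N]).
have ex : exists r, `[< kraus Phi r >] by case: cpPhi => r /asboolP; exists r.
case: (ex_minnP ex) => r /asboolP kr rmin.
by exists r; split=> // s /asboolP/rmin.
Qed.

Definition is_dual (R : realType) (d1 d2 : nat)
    (Phi : linmap R d1 d2) (Psi : linmap R d2 d1) : Prop :=
  forall (X : 'M[R[i]]_d1) (Y : 'M[R[i]]_d2),
    \tr (adjmx (Phi X) *m Y) = \tr (adjmx X *m Psi Y).

(* The default 0 is never used: see [dual_mapP]. *)
Definition dual_map (R : realType) (d1 d2 : nat) (Phi : linmap R d1 d2) :
  linmap R d2 d1 := xget 0 [set Psi | is_dual Phi Psi].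

Lemma mxtrace_adjmx (R : realType) (m n : nat) (A B : 'M[R[i]]_(m, n)) :
  \tr (adjmx A *m B) = \sum_i \sum_j Num.conj (A i j) * B i j.
Proof.
rewrite /mxtrace exchange_big /=; apply: eq_bigr => j _.
by rewrite !mxE; apply: eq_bigr => i _; rewrite !mxE.
Qed.

Lemma mxtrace_adjmx_delta (R : realType) (m n : nat) (i : 'I_m) (j : 'I_n)
  (B : 'M[R[i]]_(m, n)) : \tr (adjmx (delta_mx i j) *m B) = B i j.
Proof.
rewrite mxtrace_adjmx (bigD1 i) //= (bigD1 j) //= !mxE !eqxx conjC1 mul1r.
rewrite !big1 ?addr0 // => [i' ni'|j' nj']; last first.
  by rewrite !mxE (negPf nj') andbF conjC0 mul0r.
by apply: big1 => j' _; rewrite !mxE (negPf ni') conjC0 mul0r.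
Qed.

Lemma is_dual_ex (R : realType) (d1 d2 : nat) (Phi : linmap R d1 d2) :
  exists Psi : linmap R d2 d1, is_dual Phi Psi.
Proof.
pose f (Y : 'M[R[i]]_d2) : 'M[R[i]]_d1 :=
  \matrix_(i, j) \tr (adjmx (Phi (delta_mx i j)) *m Y).
have flin : linear f.
  by move=> a Y Z; apply/matrixP => i j; rewrite !mxE mulmxDr -scalemxAr linearP.
pose F := HB.pack_for {linear 'M[R[i]]_d2 -> 'M[R[i]]_d1} f
  (GRing.isLinear.Build _ _ _ _ f flin).
exists (linfun F) => X Y; rewrite lfunE /= [in RHS]mxtrace_adjmx.
rewrite {1}[X]matrix_sum_delta linear_sum mxtrace_adjmx.
rewrite -(mxtrace_adjmx _ Y) /adjmx !linear_sum /= map_mx_sum mulmx_suml linear_sum.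
apply: eq_bigr => i _; rewrite !linear_sum /= map_mx_sum mulmx_suml linear_sum.
apply: eq_bigr => j _; rewrite !linearZ /= map_mxZ -scalemxAl linearZ /=.
by rewrite !mxE.
Qed.

Lemma is_dual_uniq (R : realType) (d1 d2 : nat) (Phi : linmap R d1 d2)
    (Psi Psi' : linmap R d2 d1) :
  is_dual Phi Psi -> is_dual Phi Psi' -> Psi = Psi'.
Proof.
move=> H H'; apply/lfunP => Y; apply/matrixP => i j.
by rewrite -!mxtrace_adjmx_delta -H -H'.
Qed.

Lemma dual_mapP (R : realType) (d1 d2 : nat) (Phi : linmap R d1 d2)
    (Psi : linmap R d2 d1) : is_dual Phi Psi <-> dual_map Phi = Psi.
Proof.
have H : is_dual Phi (dual_map Phi).
  exact: (@xgetPex _ 0 [set Psi | is_dual Phi Psi] (is_dual_ex Phi)).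
by split=> [|<-//]; apply: is_dual_uniq.
Qed.

Definition CPset (R : realType) (d1 d2 : nat)
    (A1 : 'M[R[i]]_d1) (A2 : 'M[R[i]]_d2) : set (linmap R d1 d2) :=
  [set Phi | [/\ completely_positive Phi, Phi 1%:M = A2 &
                 dual_map Phi 1%:M = A1]].

Definition extreme_point (R : realType) (V : lmodType R[i]) (S : set V)
    (x : V) : Prop :=
  S x /\ forall (y z : V) (t : R), S y -> S z -> 0 < t < 1 ->
    x = t%:C%C *: y + (1 - t)%:C%C *: z -> y = x /\ z = x.

(* The supremum is taken in the extended reals, hence is -oo if there are no
   extreme points. *)
Definition MR (R : realType) (d1 d2 : nat)
    (A1 : 'M[R[i]]_d1) (A2 : 'M[R[i]]_d2) : \bar R :=
  ereal_sup [set ((choi_rank Phi)%:R)%:E |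
             Phi in [set Phi | extreme_point (CPset A1 A2) Phi]].

(* Main.v *)
From HB Require Import structures.
Require Import Defs.
From mathcomp Require Import all_boot all_order all_algebra.
From mathcomp Require Import all_classical all_reals ereal.
From mathcomp Require Import sesquilinear spectral.
Import Order.TTheory GRing.Theory Num.Theory.
Set Implicit Arguments.
Unset Strict Implicit.
Unset Printing Implicit Defensive.
Local Open Scope ring_scope.

(* Let Phi(X) = \sum_j V_j^* X V_j with r operators V_j.
   If r = CR(Phi) and r^2 > d1^2 + d2^2, some Hermitian h <> 0 satisfies
   \sum h_ij V_i^* V_j = 0 and \sum h_ij V_j V_i^* = 0. Scaling h so that its
   eigenvalue of largest modulus is 1, Phi is the midpoint of the maps
   X |-> \sum (1 +- h)_ij V_i^* X V_j of the same convex set; the one with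
   1 - h has a Kraus representation with r - 1 operators, so it is not Phi and
   Phi is not extreme. As 13^2 > 2 * 9^2, this bounds the rank by 12.
   Conversely, if the r^2 pairs [V_i^* V_j, V_j V_i^* ] are linearly independent,
   then Phi is extreme with CR(Phi) = r, because the Kraus operators of any map
   occurring in a convex decomposition of Phi lie in the span of the V_j.
   For r = 12 we take V_j = W_j / 6, where the W_j are disjoint 0-1 partial
   permutation matrices whose sum has 4 ones in every row and column. *)

(** * Adjoints of matrices *)

Lemma adjmxM (R : realType) (m n p : nat) (A : 'M[R[i]]_(m, n))
    (B : 'M[R[i]]_(n, p)) : adjmx (A *m B) = adjmx B *m adjmx A.
Proof. by rewrite /adjmx trmx_mul map_mxM. Qed.

Lemma adjmxK (R : realType) (m n : nat) (A : 'M[R[i]]_(m, n)) :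
  adjmx (adjmx A) = A.
Proof. by apply/matrixP => i j; rewrite !mxE conjCK. Qed.

Lemma adjmxZ (R : realType) (m n : nat) (a : R[i]) (A : 'M[R[i]]_(m, n)) :
  adjmx (a *: A) = Num.conj a *: adjmx A.
Proof. by rewrite /adjmx linearZ map_mxZ. Qed.

Lemma adjmxD (R : realType) (m n : nat) (A B : 'M[R[i]]_(m, n)) :
  adjmx (A + B) = adjmx A + adjmx B.
Proof. by rewrite /adjmx linearD map_mxD. Qed.

Lemma adjmx_sum (R : realType) (m n : nat) (I : finType) (F : I -> 'M[R[i]]_(m, n)) :
  adjmx (\sum_i F i) = \sum_i adjmx (F i).
Proof. by rewrite /adjmx linear_sum map_mx_sum. Qed.

(** * Kraus maps and linear recombination of their operators *)

Section Kraus.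
Variables (R : realType) (d1 d2 : nat).
Local Notation C := R[i].

Definition mix (r s : nat) (B : 'M[C]_(s, r)) (V : 'I_r -> 'M[C]_(d1, d2))
  (k : 'I_s) : 'M[C]_(d1, d2) := \sum_j B k j *: V j.

(** After expansion, [B] enters only through its Gram matrix [adjmx B *m B]. *)
Lemma sum_mix_kraus (r s : nat) (B : 'M[C]_(s, r)) (V : 'I_r -> 'M[C]_(d1, d2))
    (X : 'M[C]_d1) :
  \sum_k adjmx (mix B V k) *m X *m mix B V k =
  \sum_i \sum_j (adjmx B *m B) i j *: (adjmx (V i) *m X *m V j).
Proof.
transitivity (\sum_k \sum_i \sum_j
    (Num.conj (B k i) * B k j) *: (adjmx (V i) *m X *m V j)).
  apply: eq_bigr => k _; rewrite /mix adjmx_sum !mulmx_suml; apply: eq_bigr => i _.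
  rewrite mulmx_sumr; apply: eq_bigr => j _.
  by rewrite adjmxZ -!scalemxAl -scalemxAr scalerA.
rewrite exchange_big; apply: eq_bigr => i _ /=.
rewrite exchange_big; apply: eq_bigr => j _ /=.
by rewrite -scaler_suml !mxE; congr (_ *: _); apply: eq_bigr => k _; rewrite !mxE.
Qed.

Lemma sum_mix_dual (r s : nat) (B : 'M[C]_(s, r)) (V : 'I_r -> 'M[C]_(d1, d2)) :
  \sum_k mix B V k *m adjmx (mix B V k) =
  \sum_i \sum_j (adjmx B *m B) i j *: (V j *m adjmx (V i)).
Proof.
transitivity (\sum_k \sum_i \sum_j
    (Num.conj (B k i) * B k j) *: (V j *m adjmx (V i))).
  apply: eq_bigr => k _; rewrite /mix adjmx_sum mulmx_sumr; apply: eq_bigr => i _.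
  rewrite mulmx_suml; apply: eq_bigr => j _.
  by rewrite adjmxZ -!scalemxAl -scalemxAr scalerA mulrC.
rewrite exchange_big; apply: eq_bigr => i _ /=.
rewrite exchange_big; apply: eq_bigr => j _ /=.
by rewrite -scaler_suml !mxE; congr (_ *: _); apply: eq_bigr => k _; rewrite !mxE.
Qed.

Definition kraus_fun (r : nat) (V : 'I_r -> 'M[C]_(d1, d2)) (X : 'M[C]_d1) :
  'M[C]_d2 := \sum_j adjmx (V j) *m X *m V j.

Fact kraus_fun_linear (r : nat) (V : 'I_r -> 'M[C]_(d1, d2)) :
  linear (kraus_fun V).
Proof.
move=> a X Y; rewrite /kraus_fun scaler_sumr -big_split; apply: eq_bigr => j _ /=.
by rewrite mulmxDr mulmxDl -scalemxAr -scalemxAl.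
Qed.

HB.instance Definition _ (r : nat) (V : 'I_r -> 'M[C]_(d1, d2)) :=
  GRing.isLinear.Build C 'M[C]_d1 'M[C]_d2 _ (kraus_fun V) (kraus_fun_linear V).

Definition kraus_map (r : nat) (V : 'I_r -> 'M[C]_(d1, d2)) : linmap R d1 d2 :=
  linfun (kraus_fun V).

Lemma kraus_mapE (r : nat) (V : 'I_r -> 'M[C]_(d1, d2)) (X : 'M[C]_d1) :
  kraus_map V X = \sum_j adjmx (V j) *m X *m V j.
Proof. by rewrite lfunE. Qed.

Lemma krausP (Phi : linmap R d1 d2) (r : nat) :
  kraus Phi r <-> exists V : 'I_r -> 'M[C]_(d1, d2), Phi = kraus_map V.
Proof.
split=> -[V PhiV]; exists V; last by move=> X; rewrite PhiV kraus_mapE.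
by apply/lfunP => X; rewrite PhiV kraus_mapE.
Qed.

End Kraus.

Lemma dual_kraus_map (R : realType) (d1 d2 r : nat) (V : 'I_r -> 'M[R[i]]_(d1, d2)) :
  dual_map (kraus_map V) = kraus_map (fun j => adjmx (V j)).
Proof.
apply/dual_mapP => X Y; rewrite !kraus_mapE adjmx_sum mulmx_suml mulmx_sumr.
rewrite !linear_sum; apply: eq_bigr => j _ /=.
by rewrite !adjmxM adjmxK -!mulmxA mxtrace_mulC !mulmxA.
Qed.

(** * The Choi form and the span of the Kraus operators *)

Section ChoiForm.
Variables (R : realType) (d1 d2 : nat).
Local Notation C := R[i].

Lemma kraus_map_CPset (A1 : 'M[C]_d1) (A2 : 'M[C]_d2) (r : nat)
    (V : 'I_r -> 'M[C]_(d1, d2)) :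
  CPset A1 A2 (kraus_map V) <->
  \sum_j adjmx (V j) *m V j = A2 /\ \sum_j V j *m adjmx (V j) = A1.
Proof.
have eA2 : kraus_map V 1%:M = \sum_j adjmx (V j) *m V j.
  by rewrite kraus_mapE; apply: eq_bigr => j _; rewrite mulmx1.
have eA1 : dual_map (kraus_map V) 1%:M = \sum_j V j *m adjmx (V j).
  by rewrite dual_kraus_map kraus_mapE; apply: eq_bigr => j _; rewrite mulmx1 adjmxK.
split=> [[_]|[h2 h1]]; first by rewrite eA1 eA2.
by split; rewrite ?eA1 ?eA2 //; exists r; apply/krausP; exists V.
Qed.

Lemma kraus_map_mix (r s : nat) (B : 'M[C]_(s, r)) (V : 'I_r -> 'M[C]_(d1, d2)) :
  adjmx B *m B = 1%:M -> kraus_map (mix B V) = kraus_map V.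
Proof.
move=> B1; apply/lfunP => X; rewrite !kraus_mapE sum_mix_kraus B1.
apply: eq_bigr => i _; rewrite (bigD1 i) //= big1 => [|j ji].
  by rewrite mxE eqxx scale1r addr0.
by rewrite mxE eq_sym (negPf ji) scale0r.
Qed.

(* The quadratic form of the Choi matrix of [Phi] at the vectorization of [Z]. *)
Definition choi_form (Phi : linmap R d1 d2) (Z : 'M[C]_(d1, d2)) : C :=
  \sum_a \sum_b (row a Z *m Phi (delta_mx a b) *m adjmx (row b Z)) 0 0.

Lemma choi_form_kraus (r : nat) (V : 'I_r -> 'M[C]_(d1, d2)) (Z : 'M[C]_(d1, d2)) :
  choi_form (kraus_map V) Z = \sum_j `|\tr (Z *m adjmx (V j))| ^+ 2.
Proof.
have trE j : \tr (Z *m adjmx (V j)) = \sum_a (row a Z *m adjmx (row a (V j))) 0 0.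
  by apply: eq_bigr => a _; rewrite !mxE; apply: eq_bigr => k _; rewrite !mxE.
transitivity (\sum_a \sum_b \sum_j
    (row a Z *m adjmx (row a (V j))) 0 0 * Num.conj ((row b Z *m adjmx (row b (V j))) 0 0)).
  apply: eq_bigr => a _; apply: eq_bigr => b _.
  rewrite kraus_mapE mulmx_sumr mulmx_suml summxE; apply: eq_bigr => j _.
  (* A matrix unit is a column times a row, so the summand splits into a factor in [a] and the
     conjugate of the same factor in [b]. *)
  have -> : delta_mx a b = delta_mx a (0 : 'I_1) *m delta_mx 0 b :> 'M[C]_d1.
    by rewrite mul_delta_mx.
  have -> : row a Z *m (adjmx (V j) *m (delta_mx a (0 : 'I_1) *m delta_mx 0 b) *m V j) *m
     adjmx (row b Z) = (row a Z *m adjmx (row a (V j))) *m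
     adjmx (row b Z *m adjmx (row b (V j))).
    rewrite [adjmx (_ *m _)]adjmxM adjmxK !(rowE _ (V j)) adjmxM.
    have -> : adjmx (delta_mx 0 a) = delta_mx a 0 :> 'M[C]_(d1, 1).
      by apply/matrixP => x y; rewrite !mxE rmorph_nat andbC.
    by rewrite !mulmxA.
  by rewrite mxE big_ord1; congr (_ * _); rewrite !mxE.
under eq_bigr => a _ do rewrite exchange_big /=.
rewrite exchange_big; apply: eq_bigr => j _ /=.
rewrite normCK trE rmorph_sum mulr_suml; apply: eq_bigr => a _.
by rewrite mulr_sumr.
Qed.

Lemma choi_form_ge0 (Phi : linmap R d1 d2) (Z : 'M[C]_(d1, d2)) :
  completely_positive Phi -> 0 <= choi_form Phi Z.
Proof.
case=> r /krausP [V ->]; rewrite choi_form_kraus.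
by apply: sumr_ge0 => j _; rewrite exprn_ge0.
Qed.

Lemma choi_form_comb (a b : C) (Phi Psi : linmap R d1 d2) (Z : 'M[C]_(d1, d2)) :
  choi_form (a *: Phi + b *: Psi) Z = a * choi_form Phi Z + b * choi_form Psi Z.
Proof.
rewrite /choi_form !mulr_sumr -big_split; apply: eq_bigr => i _ /=.
rewrite !mulr_sumr -big_split; apply: eq_bigr => j _ /=.
by rewrite !lfunE /= !lfunE /= mulmxDr mulmxDl -!scalemxAr -!scalemxAl !mxE.
Qed.

(* If [Z] is orthogonal to all [V j], the first form vanishes at [Z], hence so
   does the second, and [Z] is orthogonal to all [U k]. *)
Lemma mix_of_choi_form (r s : nat) (V : 'I_r -> 'M[C]_(d1, d2))
    (U : 'I_s -> 'M[C]_(d1, d2)) :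
  (forall Z, choi_form (kraus_map V) Z = 0 -> choi_form (kraus_map U) Z = 0) ->
  exists B : 'M[C]_(s, r), forall k, U k = mix B V k.
Proof.
move=> VU.
pose M n (W : 'I_n -> 'M[C]_(d1, d2)) : 'M[C]_(n, d1 * d2) := \matrix_j mxvec (W j).
have trM n (W : 'I_n -> 'M[C]_(d1, d2)) (z : 'cV[C]_(d1 * d2)) j :
    \tr (map_mx Num.conj (vec_mx z^T) *m adjmx (W j)) = Num.conj ((M n W *m z) j 0).
  rewrite [in RHS]mxE rmorph_sum (reindex _ (curry_mxvec_bij _ _)) /=.
  transitivity (\sum_a \sum_k Num.conj (M n W j (mxvec_index a k) *
     z (mxvec_index a k) 0)); last by rewrite pair_bigA; apply: eq_bigr => -[].
  apply: eq_bigr => a _; rewrite mxE; apply: eq_bigr => k _.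
  by rewrite !mxE mxvecE rmorphM mulrC.
suff /submxP [B MU] : (M s U <= M r V)%MS.
  exists B => k; apply: (can_inj mxvecK); rewrite linear_sum /=.
  have := congr1 (row k) MU; rewrite rowK => ->.
  rewrite row_mul mulmx_sum_row; apply: eq_bigr => j _.
  by rewrite rowK linearZ mxE.
(* Each column [z] of the cokernel matrix is killed by [M r V]; by [trM] it yields a matrix
   orthogonal to all [V j], where the hypothesis applies. *)
rewrite submxE; apply/eqP/matrixP => k l; rewrite [RHS]mxE.
set z := col l (cokermx (M r V)).
have Mz0 : M r V *m z = 0 by rewrite /z colE mulmxA mulmx_coker mul0mx.
have : choi_form (kraus_map U) (map_mx Num.conj (vec_mx z^T)) = 0.
  apply: VU; rewrite choi_form_kraus big1 // => j _.
  by rewrite trM Mz0 mxE rmorph0 normr0 expr0n.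
rewrite choi_form_kraus => /eqP; rewrite psumr_eq0 => [|j _]; last exact: exprn_ge0.
move=> /allP/(_ k (mem_index_enum _)) /=.
rewrite expf_eq0 /= normr_eq0 trM conjC_eq0 /z colE mulmxA -colE => /eqP.
by rewrite mxE.
Qed.

(** Choi forms of completely positive maps are nonnegative, so where the form of the combination
    vanishes, so does that of the term with positive weight. *)
Lemma mix_of_convex (r s : nat) (V : 'I_r -> 'M[C]_(d1, d2))
    (U : 'I_s -> 'M[C]_(d1, d2)) (Omega : linmap R d1 d2) (t u : C) :
  0 < t -> 0 <= u -> completely_positive Omega ->
  kraus_map V = t *: kraus_map U + u *: Omega ->
  exists B : 'M[C]_(s, r), forall k, U k = mix B V k.
Proof.
move=> t0 u0 cpO VE; apply: mix_of_choi_form => Z /eqP.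
rewrite VE choi_form_comb paddr_eq0.
- by rewrite mulf_eq0 gt_eqF //= => /andP [/eqP].
- apply: (mulr_ge0 (ltW t0)); apply: choi_form_ge0.
  by exists s; apply/krausP; exists U.
- by apply: (mulr_ge0 u0); apply: choi_form_ge0.
Qed.

Lemma sum_1mx (r : nat) (W : lmodType C) (F : 'I_r -> 'I_r -> W) :
  \sum_i \sum_j (1%:M : 'M[C]_r) i j *: F i j = \sum_i F i i.
Proof.
apply: eq_bigr => i _; rewrite (bigD1 i) //= mxE eqxx scale1r big1 ?addr0 // => j.
by rewrite mxE eq_sym => /negPf ->; rewrite scale0r.
Qed.

(** * Extremality and Choi-rank from independence of the pairs *)

Section Free.
Variables (r : nat) (V : 'I_r -> 'M[C]_(d1, d2)).
Hypothesis freeV : forall c : 'M[C]_r,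
  \sum_i \sum_j c i j *: (adjmx (V i) *m V j) = 0 ->
  \sum_i \sum_j c i j *: (V j *m adjmx (V i)) = 0 -> c = 0.

Lemma free_sum_sub (W : lmodType C) (c e : 'M[C]_r) (F : 'I_r -> 'I_r -> W) :
  \sum_i \sum_j c i j *: F i j = \sum_i \sum_j e i j *: F i j ->
  \sum_i \sum_j (c - e) i j *: F i j = 0.
Proof.
move=> /eqP; rewrite -subr_eq0 -sumrB => /eqP h; rewrite -[RHS]h.
apply: eq_bigr => i _; rewrite -sumrB; apply: eq_bigr => j _.
by rewrite !mxE scalerBl.
Qed.

(** Both maps and their duals agree at the identity, so [adjmx B *m B - 1%:M] is a relation between
    the pairs. Independence makes [B] an isometry, which leaves the map unchanged. *)
Lemma free_CPset_eq (s : nat) (B : 'M[C]_(s, r)) (A1 : 'M[C]_d1) (A2 : 'M[C]_d2) :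
  CPset A1 A2 (kraus_map V) -> CPset A1 A2 (kraus_map (mix B V)) ->
  kraus_map (mix B V) = kraus_map V.
Proof.
move=> /kraus_map_CPset [V2 V1] /kraus_map_CPset [B2 B1].
apply/kraus_map_mix/eqP; rewrite -subr_eq0; apply/eqP; apply: freeV; apply: free_sum_sub.
  rewrite sum_1mx V2 -B2.
  have := sum_mix_kraus B V 1%:M.
  under eq_bigr => k _ do rewrite mulmx1.
  move=> ->; apply: eq_bigr => i _; apply: eq_bigr => j _; by rewrite mulmx1.
by rewrite sum_1mx V1 -B1 sum_mix_dual.
Qed.

Lemma free_extreme (A1 : 'M[C]_d1) (A2 : 'M[C]_d2) :
  CPset A1 A2 (kraus_map V) -> extreme_point (CPset A1 A2) (kraus_map V).
Proof.
move=> SV; split=> // Psi Omega t SPsi SOmega /andP [t0 t1] VE.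
have t0' : (0 : C) < t%:C%C by rewrite ltcR.
have t1' : (0 : C) < (1 - t)%:C%C by rewrite ltcR subr_gt0.
have aux (u v : C) (P O : linmap R d1 d2) : CPset A1 A2 P -> CPset A1 A2 O ->
    0 < u -> 0 < v -> kraus_map V = u *: P + v *: O -> P = kraus_map V.
  move=> SP [cpO _ _] u0 v0; have [[s /krausP [U PE]] _ _] := SP.
  move: SP; rewrite {P}PE => SU VUO.
  have [B UB] := mix_of_convex u0 (ltW v0) cpO VUO.
  have UE : kraus_map U = kraus_map (mix B V).
    by apply/lfunP => X; rewrite !kraus_mapE; apply: eq_bigr => k _; rewrite UB.
  by rewrite UE in SU *; apply: free_CPset_eq SV SU.
split; first exact: aux SPsi SOmega t0' t1' VE.
by apply: aux SOmega SPsi t1' t0' _; rewrite addrC.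
Qed.

(** Writing [V] through a shortest Kraus family [U] gives a matrix [B] with [r] rows and Choi-rank
    many columns; its rows are independent because the [V j] are. *)
Lemma free_choi_rank : choi_rank (kraus_map V) = r.
Proof.
have krV : kraus (kraus_map V) r by apply/krausP; exists V.
have [/krausP [U VU] minr] := choi_rankP (ex_intro _ _ krV).
apply/eqP; rewrite eqn_leq minr //=.
have [|B VB] := @mix_of_choi_form _ _ U V.
  by move=> Z; rewrite -VU.
suff /eqP rB : row_free B by have := rank_leq_col B; rewrite rB.
apply: inj_row_free => v vB0.
have vV0 : \sum_j v 0 j *: V j = 0.
  under eq_bigr => j _ do rewrite VB /mix scaler_sumr.
  rewrite exchange_big big1 // => k _ /=.
  under eq_bigr => j _ do rewrite scalerA.
  by rewrite -scaler_suml; move/rowP/(_ k): vB0; rewrite !mxE => ->; rewrite scale0r.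
apply/rowP => j0.
(* With [v] as row [j0] of an otherwise zero matrix, the relation between the [V j] becomes one
   between the pairs. *)
suff /matrixP/(_ j0 j0) : (\matrix_(i, j) (v 0 j *+ (i == j0)) : 'M[C]_r) = 0.
  by rewrite !mxE eqxx.
have sum_row (W : lmodType C) (F : 'I_r -> 'I_r -> W) :
    \sum_i \sum_j (\matrix_(i, j) (v 0 j *+ (i == j0)) : 'M[C]_r) i j *: F i j
    = \sum_j v 0 j *: F j0 j.
  rewrite (bigD1 j0) //= [X in _ + X]big1 ?addr0 => [|i /negPf ij0].
    by apply: eq_bigr => j _; rewrite mxE eqxx.
  by apply: big1 => j _; rewrite mxE ij0 scale0r.
apply: freeV; rewrite sum_row.
  under eq_bigr => j _ do rewrite scalemxAr.
  by rewrite -mulmx_sumr vV0 mulmx0.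
under eq_bigr => j _ do rewrite scalemxAl.
by rewrite -mulmx_suml vV0 mul0mx.
Qed.

End Free.
End ChoiForm.

(** * Upper bound on the Choi-rank of an extreme point *)

Lemma linear_kernel_neq0 (F : fieldType) (m n : nat)
    (f : {linear 'rV[F]_m -> 'rV[F]_n}) :
  (n < m)%N -> exists2 u, u != 0 & f u = 0.
Proof.
move=> ltnm; have : kermx (lin1_mx f) != 0.
  rewrite kermx_eq0 /row_free neq_ltn.
  by rewrite (leq_ltn_trans (rank_leq_col _) ltnm).
by case/rowV0Pn => u /sub_kermxP fu u0; exists u; rewrite // -mul_rV_lin1.
Qed.

Section ExtremePoint.
Variables (R : realType) (d1 d2 : nat).
Local Notation C := R[i].

Lemma kraus_drop (r : nat) (W : 'I_r -> 'M[C]_(d1, d2)) (k : 'I_r) :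
  W k = 0 -> kraus (kraus_map W) r.-1.
Proof.
case: r W k => [W []//|r] W k Wk0; exists (fun j => W (lift k j)) => X.
by rewrite kraus_mapE (bigD1_ord k) //= Wk0 mulmx0 add0r.
Qed.

Definition pairing (r n : nat) (F : 'I_r -> 'I_r -> 'M[C]_n) (c : 'M[C]_r) :
  'M[C]_n := \sum_i \sum_j c i j *: F i j.

Lemma pairing_linear (r n : nat) (F : 'I_r -> 'I_r -> 'M[C]_n) : linear (pairing F).
Proof.
move=> a c e; rewrite /pairing scaler_sumr -big_split; apply: eq_bigr => i _ /=.
rewrite scaler_sumr -big_split; apply: eq_bigr => j _ /=.
by rewrite !mxE scalerDl scalerA.
Qed.

HB.instance Definition _ (r n : nat) (F : 'I_r -> 'I_r -> 'M[C]_n) :=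
  GRing.isLinear.Build C 'M[C]_r 'M[C]_n _ (pairing F) (pairing_linear F).

(** This closes the relations between the pairs under adjoints, so that a Hermitian one can be
    chosen. *)
Lemma pairing_adj (r n : nat) (F : 'I_r -> 'I_r -> 'M[C]_n) (c : 'M[C]_r) :
  (forall i j, adjmx (F i j) = F j i) ->
  adjmx (pairing F c) = pairing F (adjmx c).
Proof.
move=> adjF; rewrite /pairing exchange_big /= adjmx_sum; apply: eq_bigr => i _.
rewrite adjmx_sum; apply: eq_bigr => j _.
by rewrite adjmxZ adjF !mxE.
Qed.

Lemma extreme_choi_rank (A1 : 'M[C]_d1) (A2 : 'M[C]_d2) (Phi : linmap R d1 d2) :
  extreme_point (CPset A1 A2) Phi ->
  (choi_rank Phi ^ 2 <= d1 ^ 2 + d2 ^ 2)%N.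
Proof.
move=> [SPhi extPhi]; have [cpPhi _ _] := SPhi.
have [/krausP [V PhiV] rmin] := choi_rankP cpPhi.
move: V PhiV rmin; set r := choi_rank Phi => V PhiV rmin.
rewrite leqNgt; apply/negP; rewrite -!mulnn => ltdr.
pose F2 (i j : 'I_r) := adjmx (V i) *m V j.
pose F1 (i j : 'I_r) := V j *m adjmx (V i).
have adjF1 i j : adjmx (F1 i j) = F1 j i by rewrite /F1 adjmxM adjmxK.
have adjF2 i j : adjmx (F2 i j) = F2 j i by rewrite /F2 adjmxM adjmxK.
(* There are [d1 * d1 + d2 * d2] linear equations in [r * r] unknowns. *)
have [c c0 [F1c F2c]] : exists2 c : 'M[C]_r, c != 0 & pairing F1 c = 0 /\ pairing F2 c = 0.
  pose f (u : 'rV[C]_(r * r)) : 'rV[C]_(d1 * d1 + d2 * d2) :=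
    row_mx (mxvec (pairing F1 (vec_mx u))) (mxvec (pairing F2 (vec_mx u))).
  have flin : linear f.
    by move=> a u v; rewrite /f !linearP scale_row_mx add_row_mx.
  pose fL := HB.pack_for {linear 'rV[C]_(r * r) -> 'rV[C]_(d1 * d1 + d2 * d2)} f
    (GRing.isLinear.Build _ _ _ _ f flin).
  have [u u0 /= fu0] := @linear_kernel_neq0 _ _ _ fL ltdr.
  exists (vec_mx u).
    by apply: contra u0 => /eqP v0; rewrite -(vec_mxK u) v0 linear0.
  move: fu0; rewrite /f -[RHS]row_mx0 => /eq_row_mx [].
  by split; apply: (can_inj mxvecK); rewrite linear0.
have {c c0 F1c F2c} [h [hh h0 F1h F2h]] : exists h : 'M[C]_r,
    [/\ adjmx h = h, h != 0, pairing F1 h = 0 & pairing F2 h = 0].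
  (* If [c + adjmx c] vanishes, [c] is skew-Hermitian and ['i *: c] is Hermitian. *)
  have [cN|cD] := eqVneq (c + adjmx c) 0.
    exists ('i *: c); split; last 2 first.
    - by rewrite linearZ /= F1c scaler0.
    - by rewrite linearZ /= F2c scaler0.
    - move/eqP: cN; rewrite addrC addr_eq0 => /eqP cN.
      by rewrite adjmxZ cN conjCi scaleNr scalerN opprK.
    - by rewrite scaler_eq0 negb_or neq0Ci c0.
  exists (c + adjmx c); split=> //.
  - by rewrite adjmxD adjmxK addrC.
  - by rewrite linearD /= -pairing_adj // F1c /adjmx trmx0 map_mx0 addr0.
  - by rewrite linearD /= -pairing_adj // F2c /adjmx trmx0 map_mx0 addr0.
have hherm : h \is hermsymmx.
  by apply/is_hermitianmxP; rewrite expr0 scale1r; exact: esym.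
pose P := spectralmx h.
have hE := orthomx_spectralP (hermitian_normalmx hherm).
have PU : P \is unitarymx by exact: spectral_unitarymx.
rewrite -/P invmx_unitary // in hE.
have adjPP : adjmx P *m P = 1%:M.
  by have := mulVmx (unitarymx_unit PU); rewrite invmx_unitary.
pose x k : R := complex.Re (spectral_diag h 0 k).
have xE k : spectral_diag h 0 k = (x k)%:C%C.
  have /mxOverP/(_ 0 k) := hermitian_spectral_diag_real hherm.
  by move=> /RRe_real.
have [k1 xk1] : exists k, x k != 0.
  apply/existsP; apply: contraNT h0; rewrite negb_exists => /forallP x0.
  rewrite hE; suff -> : spectral_diag h = 0 by rewrite linear0 mulmx0 mul0mx.
  by apply/rowP => k; rewrite xE mxE; have := x0 k; rewrite negbK => /eqP ->.
have [k0 _ xmax] := @Order.TotalTheory.arg_maxP _ _ _ k1 xpredT (fun k => `|x k|) isT.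
have {}xmax k : `|x k| <= `|x k0| by exact: xmax.
have xk0 : x k0 != 0.
  by rewrite -normr_gt0 (lt_le_trans _ (xmax k1)) // normr_gt0.
(* These are the eigenvalues of the identity plus [e / x k0] times [h]. *)
pose w (e : R) k := 1 + e * (x k / x k0).
have w_ge0 e k : `|e| = 1 -> 0 <= w e k.
  move=> e1; rewrite -lerBlDl sub0r.
  suff : `|e * (x k / x k0)| <= 1 by rewrite ler_norml => /andP [].
  by rewrite normrM e1 mul1r normrM normfV ler_pdivrMr ?normr_gt0 // mul1r xmax.
(* [1 + (e / x k0) h] is positive for [e = 1] and [e = -1], with a singular
   square root [B e] in the second case. *)
pose B e : 'M[C]_r := \matrix_(k, j) ((Num.sqrt (w e k))%:C%C * P k j).
have BE e : `|e| = 1 -> adjmx (B e) *m B e = 1%:M + (e / x k0)%:C%C *: h.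
  move=> e1; rewrite -adjPP hE -mulmxA; apply/matrixP => i j.
  rewrite [LHS]mxE [RHS]mxE [X in _ = X + _]mxE [X in _ = _ + X]mxE [X in _ = _ + _ * X]mxE.
  rewrite mulr_sumr -big_split; apply: eq_bigr => k _ /=.
  rewrite mul_diag_mx !mxE xE rmorphM /= mulrACA.
  have -> : Num.conj (Num.sqrt (w e k))%:C%C * (Num.sqrt (w e k))%:C%C = (w e k)%:C%C :> C.
    rewrite conj_Creal; last by apply/complex_realP; eexists.
    by rewrite -rmorphM -expr2 sqr_sqrtr // w_ge0.
  rewrite /w rmorphD rmorphM /= mulrDl rmorph1 mul1r; congr (_ + _).
  by rewrite !rmorphM /= -!mulrA 2![in RHS](mulrCA _ (x k)%:C%C).
pose Psi e := kraus_map (mix (B e) V).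
have PsiE e X : `|e| = 1 -> Psi e X = Phi X + (e / x k0)%:C%C *:
    \sum_i \sum_j h i j *: (adjmx (V i) *m X *m V j).
  move=> e1; rewrite kraus_mapE sum_mix_kraus BE // PhiV kraus_mapE.
  rewrite -(sum_1mx (fun i j => adjmx (V i) *m X *m V j)).
  rewrite scaler_sumr -big_split; apply: eq_bigr => i _ /=.
  rewrite scaler_sumr -big_split; apply: eq_bigr => j _ /=.
  by rewrite scalerA -scalerDl !mxE.
(* Both pairings vanish at [h], so the perturbation keeps the values of the map and its dual at the
   identity. *)
have SPsi e : `|e| = 1 -> CPset A1 A2 (Psi e).
  move=> e1; move: SPhi; rewrite PhiV => /kraus_map_CPset [V2 V1].
  have pairB n (F : 'I_r -> 'I_r -> 'M[C]_n) : pairing F h = 0 ->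
      pairing F (adjmx (B e) *m B e) = \sum_i F i i.
    by move=> Fh; rewrite BE // linearD linearZ /= Fh scaler0 addr0 [LHS]sum_1mx.
  apply/kraus_map_CPset; split; last first.
    by rewrite sum_mix_dual -V1 -[RHS](pairB _ F1).
  under eq_bigr => k _ do rewrite -[adjmx _]mulmx1.
  rewrite sum_mix_kraus -V2 -[RHS](pairB _ F2) //.
  by apply: eq_bigr => i _; apply: eq_bigr => j _; rewrite mulmx1.
have half : 0 < (2%:R^-1 : R) < 1 by rewrite invr_gt0 invf_lt1 ltr0n ?ltr1n.
have n1 : `|1 : R| = 1 by rewrite normr1.
have nN1 : `|-1 : R| = 1 by rewrite normrN1.
have halfB : 1 - 2%:R^-1 = 2%:R^-1 :> R by rewrite {1}[1]splitr mul1r addrK.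
have [|_ PsiN] := extPhi _ _ _ (SPsi 1 n1) (SPsi (-1) nN1) half.
  apply/lfunP => X; rewrite halfB !lfunE /= !lfunE /= !PsiE //.
  rewrite -scalerDr mulNr rmorphN scaleNr addrACA subrr addr0 -mulr2n -scaler_nat scalerA.
  by rewrite fmorphV rmorph_nat mulVf ?scale1r // pnatr_eq0.
have : kraus Phi r.-1.
  (* Since [w (-1) k0] is 0, row [k0] of [B (-1)] vanishes, and so does the Kraus operator of index
     [k0]. *)
  rewrite -PsiN; apply: (kraus_drop (k := k0)).
  rewrite /mix big1 // => j _; rewrite mxE /w divff // mulr1 subrr sqrtr0.
  by rewrite mul0r scale0r.
by move/rmin; rewrite leqNgt ltn_predL (leq_ltn_trans _ (ltn_ord k0)).
Qed.
End ExtremePoint.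

(** * Elimination of unknowns by computation *)

(* One elimination step. The pair [PM] stands for a relation between sums of
   unknowns; if, after discarding the unknowns known to vanish, its two sides
   differ by a positive multiple of a single unknown [v], then [v] vanishes. *)
Definition peel (T : eqType) (known : seq T) (PM : seq T * seq T) : seq T :=
  let P := [seq u <- PM.1 | u \notin known] in
  let M := [seq u <- PM.2 | u \notin known] in
  if [seq u <- P | u \notin M] is v :: _ then
    if (size M < size P)%N && perm_eq P (nseq (size P - size M) v ++ M)
    then v :: known else known
  else known.

(** Cancelling the common part [M] leaves a positive integer multiple of [x v] equal to 0. *)
Lemma peelP (T : eqType) (F : numDomainType) (x : T -> F) (known : seq T)
    (PM : seq T * seq T) :
  \sum_(u <- PM.1) x u = \sum_(u <- PM.2) x u -> {in known, forall u, x u = 0} ->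
  {in peel known PM, forall u, x u = 0}.
Proof.
move=> PMx known0.
have dropK s : \sum_(u <- s) x u = \sum_(u <- [seq u <- s | u \notin known]) x u.
  rewrite big_filter [LHS](bigID (fun u => u \in known)) /= big1 ?add0r //.
rewrite /peel /=; case: (@seq.filter T _ (@seq.filter T _ _)) => [//|v _].
case: ifP => // /andP [ltMP permP].
move: PMx; rewrite dropK [RHS]dropK (perm_big _ permP) big_cat /= => /eqP.
rewrite -subr_eq0 addrK big_nseq iter_addr_0 => /eqP.
move=> xv0 u; rewrite inE => /predU1P [->|/known0 //].
move/eqP: xv0; rewrite mulrn_eq0 subn_eq0 leqNgt ltMP.
by move=> /eqP.
Qed.

Lemma foldl_peelP (T : eqType) (F : numDomainType) (x : T -> F)
    (relations : seq (seq T * seq T)) (known : seq T) :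
  {in relations, forall PM, \sum_(u <- PM.1) x u = \sum_(u <- PM.2) x u} ->
  {in known, forall u, x u = 0} ->
  {in foldl (@peel T) known relations, forall u, x u = 0}.
Proof.
elim: relations known => //= PM relations IH known relP known0; apply: IH.
  by move=> QN QNs; apply: relP; rewrite inE QNs orbT.
by apply: peelP => //; apply: relP; rewrite inE eqxx.
Qed.

(** * The table of partial permutations and its finite checks *)

(* Found by computer search. The entry [j] in row [k] and column [a] puts a 1
   at position (k, a) of the j-th matrix; 12 marks an unused position. Every row
   and column uses 4 positions, and no label is repeated in a row or column. *)
Definition label_table : seq (seq nat) :=
  [:: [::  6;  3; 12; 12; 12; 12; 11;  0; 12];
      [:: 12;  8; 12;  4; 12; 10; 12; 12;  5];
      [::  8; 12; 12; 12;  4; 11;  2; 12; 12];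
      [:: 12; 10;  0;  3; 12;  9; 12; 12; 12];
      [:: 12; 12; 12;  1;  9;  7;  5; 12; 12];
      [::  1; 12;  4;  2; 10; 12; 12; 12; 12];
      [::  9; 12;  8; 12; 12; 12; 12;  2;  6];
      [:: 12; 12;  7; 12; 12; 12;  3;  1;  2];
      [:: 12;  7; 12; 12;  6; 12; 12; 11;  0]].

Definition label (k a : nat) : nat := nth 12 (nth [::] label_table k) a.

(* The coefficients c i j that occur in the entry (p, q) of
   36 * \sum_(i, j) c i j V_i^* V_j (for [s = true]), resp. of
   36 * \sum_(i, j) c i j V_j V_i^* (for [s = false]). *)
Definition label_pairs (e : bool * nat * nat) : seq (nat * nat) :=
  let: (s, p, q) := e in
  [seq u <- if s then [seq (label k p, label k q) | k <- iota 0 9]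
            else [seq (label q a, label p a) | a <- iota 0 9]
     | (u.1 < 12) && (u.2 < 12)]%N.

Definition all_label_pairs (s : bool) : seq (seq (nat * nat)) :=
  [seq label_pairs (s, p, q) | p <- iota 0 9, q <- iota 0 9].

Definition col_pairs (a : nat) := label_pairs (true, a, a).
Definition row_pairs (k : nat) := label_pairs (false, k, k).

(* The entries (p, q) with p <> q involve off-diagonal coefficients only, and
   those are eliminated one at a time by single relations; the diagonal system
   needs the four combinations listed first. Three sweeps over the single
   relations suffice. *)
Definition relations : seq (seq (nat * nat) * seq (nat * nat)) :=
  [:: (col_pairs 2 ++ col_pairs 3 ++ col_pairs 4 ++ row_pairs 2,
       col_pairs 7 ++ col_pairs 1 ++ row_pairs 6);
      (row_pairs 7, col_pairs 3);
      (row_pairs 0, row_pairs 8);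
      (row_pairs 5, col_pairs 3)] ++
  flatten (nseq 3 [seq (e, [::]) | e <- all_label_pairs true ++ all_label_pairs false]).

(** The elimination runs on index pairs only, hence can be evaluated; it reaches all 144
    coefficients. *)
Lemma peel_complete :
  let known := foldl (@peel _) [::] relations in
  all [in known] [seq (i, j) | i <- iota 0 12, j <- iota 0 12].
Proof. by vm_compute. Qed.

(** These counts evaluate the sums for the identity coefficient matrix. Off the diagonal they vanish
    because no label repeats in a row or column. *)
Lemma label_pairs_diag :
  all (fun s => all (fun p => all (fun q =>
    count (fun u => u.1 == u.2) (label_pairs (s, p, q)) == 4 * (p == q))%N
  (iota 0 9)) (iota 0 9)) [:: true; false].
Proof. by vm_compute. Qed.

Lemma mem_iota_ord n (p : 'I_n) : val p \in iota 0 n.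
Proof. by rewrite mem_iota ltn_ord. Qed.

(** * The twelve Kraus operators given by the table *)

Section Instance.
Variable R : realType.
Local Notation C := R[i].

(** The factor 1/6 is chosen so that four squared entries add up to 1/9. *)
Definition label_mx (j : 'I_12) : 'M[C]_9 :=
  \matrix_(k, a) (6%:R^-1 * (label k a == j)%:R).

(* The value is 0 if an index is out of range, as for the label 12. *)
Definition coeff (c : 'M[C]_12) (u : nat * nat) : C :=
  oapp (fun i => oapp (c i) 0 (insub u.2)) 0 (insub u.1 : option 'I_12).

Lemma sum_pick (n l : nat) (F : 'I_n -> C) :
  \sum_(i < n) (l == i :> nat)%:R * F i = oapp F 0 (insub l).
Proof.
case: insubP => [i _ li|ln] /=.
  rewrite (bigD1 i) //= -li eqxx mul1r big1 ?addr0 // => j ji.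
  by rewrite val_eqE eq_sym (negPf ji) mul0r.
rewrite big1 // => i _; case: eqP => [li|_]; last by rewrite mul0r.
by rewrite li ltn_ord in ln.
Qed.

Lemma sum_coeff (c : 'M[C]_12) (l m : nat) :
  \sum_i \sum_j c i j * ((6%:R^-1 * (l == i :> nat)%:R) * (6%:R^-1 * (m == j :> nat)%:R)) =
  36%:R^-1 * coeff c (l, m).
Proof.
rewrite /coeff -sum_pick mulr_sumr; apply: eq_bigr => i _.
rewrite -sum_pick !mulr_sumr; apply: eq_bigr => j _.
have -> : 36%:R^-1 = 6%:R^-1 * 6%:R^-1 :> C by rewrite -invfM -natrM.
rewrite mulrC -!mulrA; congr (_ * _); rewrite mulrCA; congr (_ * _).
Qed.

Lemma coeff_filter (c : 'M[C]_12) (s : seq (nat * nat)) :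
  \sum_(u <- [seq u <- s | (u.1 < 12) && (u.2 < 12)]%N) coeff c u =
  \sum_(u <- s) coeff c u.
Proof.
rewrite big_filter [RHS](bigID (fun u => (u.1 < 12) && (u.2 < 12)))%N /=.
rewrite [X in _ = _ + X]big1 ?addr0 // => -[l m] /=; rewrite negb_and /coeff /=.
by case: insubP => [j -> _|_ _] /=; [case: insubP => [i -> _|] | case: insubP].
Qed.

Lemma adj_label_mx j : adjmx (label_mx j) = (label_mx j)^T.
Proof.
apply/matrixP => k a; rewrite !mxE rmorphM rmorph_nat fmorphV.
by rewrite rmorph_nat.
Qed.

Lemma label_mx_col (c : 'M[C]_12) (p q : 'I_9) :
  (\sum_i \sum_j c i j *: (adjmx (label_mx i) *m label_mx j)) p q =
  36%:R^-1 * \sum_(u <- label_pairs (true, val p, val q)) coeff c u.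
Proof.
rewrite coeff_filter big_map -[iota 0 9]/(index_iota 0 9) big_mkord mulr_sumr.
under [RHS]eq_bigr => k _ do rewrite -sum_coeff.
rewrite summxE [RHS]exchange_big; apply: eq_bigr => i _ /=.
rewrite summxE [RHS]exchange_big; apply: eq_bigr => j _ /=.
rewrite !mxE mulr_sumr; apply: eq_bigr => k _.
by rewrite adj_label_mx !mxE.
Qed.

(** Here [j] is read in row [p] and [i] in row [q], hence the swap in [label_pairs]. *)
Lemma label_mx_row (c : 'M[C]_12) (p q : 'I_9) :
  (\sum_i \sum_j c i j *: (label_mx j *m adjmx (label_mx i))) p q =
  36%:R^-1 * \sum_(u <- label_pairs (false, val p, val q)) coeff c u.
Proof.
rewrite coeff_filter big_map -[iota 0 9]/(index_iota 0 9) big_mkord mulr_sumr.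
under [RHS]eq_bigr => k _ do rewrite -sum_coeff.
rewrite summxE [RHS]exchange_big; apply: eq_bigr => i _ /=.
rewrite summxE [RHS]exchange_big; apply: eq_bigr => j _ /=.
rewrite !mxE mulr_sumr; apply: eq_bigr => k _.
by rewrite adj_label_mx !mxE [X in _ * X]mulrC.
Qed.

(** Each entry of the two zero matrices gives one vanishing sum of coefficients. All of [relations]
    follow, and the elimination kills every coefficient. *)
Lemma label_mx_free (c : 'M[C]_12) :
  \sum_i \sum_j c i j *: (adjmx (label_mx i) *m label_mx j) = 0 ->
  \sum_i \sum_j c i j *: (label_mx j *m adjmx (label_mx i)) = 0 -> c = 0.
Proof.
move=> col0 row0.
have pairs0 s p q : (p < 9)%N -> (q < 9)%N -> \sum_(u <- label_pairs (s, p, q)) coeff c u = 0.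
  move=> p9 q9; have n36 : 36%:R^-1 != 0 :> C by rewrite invr_eq0 pnatr_eq0.
  apply: (mulfI n36); rewrite mulr0; case: s.
    by have /matrixP/(_ (Ordinal p9) (Ordinal q9)) := col0; rewrite label_mx_col mxE.
  by have /matrixP/(_ (Ordinal p9) (Ordinal q9)) := row0; rewrite label_mx_row mxE.
have relations0 : {in relations, forall PM,
    \sum_(u <- PM.1) coeff c u = \sum_(u <- PM.2) coeff c u}.
  move=> [P M] /=; rewrite mem_cat => /orP [|/flattenP [s]].
    by rewrite !inE !xpair_eqE => /or4P [] /andP [/eqP -> /eqP ->];
      rewrite /col_pairs /row_pairs !(big_cat, pairs0) //= ?addr0.
  move=> /nseqP [-> _] /mapP [e]; rewrite mem_cat => /orP [] /allpairsP [[p q] [p9 q9 eE]] [-> ->];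
  by move: p9 q9; rewrite !mem_iota eE big_nil => p9 q9; rewrite pairs0.
apply/matrixP => i j; rewrite mxE.
transitivity (coeff c (val i, val j)); first by rewrite /coeff /= !valK.
have known0 : {in foldl (@peel _) [::] relations, forall u, coeff c u = 0}.
  by apply: (foldl_peelP relations0) => u.
apply: known0.
apply: (allP peel_complete); apply/allpairsP; exists (val i, val j).
by rewrite !mem_iota /= !ltn_ord.
Qed.

(** The entry formulas at the identity coefficient matrix reduce this to the counts of
    [label_pairs_diag], with 4/36 = 1/9. *)
Lemma sum_label_mx : let V := label_mx in
  \sum_j adjmx (V j) *m V j = 9%:R^-1 *: 1%:M /\
  \sum_j V j *m adjmx (V j) = 9%:R^-1 *: 1%:M.
Proof.
have coeff1 s (p q : 'I_9) :
    36%:R^-1 * \sum_(u <- label_pairs (s, val p, val q)) coeff 1%:M u =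
    (9%:R^-1 *: (1%:M : 'M[C]_9)) p q.
  have -> : \sum_(u <- label_pairs (s, val p, val q)) coeff 1%:M u = (4 * (p == q))%:R :> C.
    have s2 : s \in [:: true; false] by case: (s).
    have /allP/(_ s s2)/allP/(_ _ (mem_iota_ord p)) := label_pairs_diag.
    move=> /allP/(_ _ (mem_iota_ord q))/eqP; rewrite val_eqE => <-.
    rewrite -sum1_count natr_sum [RHS]big_mkcond [LHS]big_seq [RHS]big_seq.
    apply: eq_bigr => -[l m]; rewrite mem_filter => /andP [/= /andP [l12 m12] _].
    rewrite /coeff /= !insubT /= mxE -val_eqE /=.
    by case: eqP.
  rewrite !mxE natrM mulrA; congr (_ * _).
  by rewrite -[36%N]/(9 * 4)%N natrM invfM -mulrA mulVf ?mulr1 // pnatr_eq0.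
split; apply/matrixP => p q.
  by rewrite -(coeff1 true) -label_mx_col sum_1mx.
by rewrite -(coeff1 false) -label_mx_row sum_1mx.
Qed.
End Instance.

Theorem corollary4p7 (R : realType) :
  MR (9%:R^-1 *: (1%:M : 'M[R[i]]_9)) (9%:R^-1 *: (1%:M : 'M[R[i]]_9))
    = (12%:R : R)%:E
  /\ 12 = Num.floor (Num.sqrt (9%:R ^+ 2 + 9%:R ^+ 2 - 1 : R)) :> int.
Proof.
split; last first.
  have -> : 9%:R ^+ 2 + 9%:R ^+ 2 - 1 = 161%:R :> R.
    by apply/eqP; rewrite subr_eq -!natrX -natrD natr1.
  (* With 12 and 13 written as square roots, the floor reduces to 144 <= 161 < 169. *)
  have natE n : n%:R = Num.sqrt (n ^ 2)%:R :> R.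
    by rewrite natrX sqrtr_sqr ger0_norm.
  apply/esym/floor_def; rewrite -[12%Z + 1]/13%Z -!pmulrn.
  by rewrite !(natE 12) (natE 13) ler_sqrt ?ltr_sqrt ?ler0n ?ltr0n // ler_nat ltr_nat.
apply/eqP; rewrite eq_le; apply/andP; split.
  apply: ge_ereal_sup => _ [Phi ext <-]; rewrite lee_fin ler_nat.
  have := extreme_choi_rank ext; case: (leqP (choi_rank Phi) 12) => // ltr.
  by rewrite leqNgt (@leq_trans (13 ^ 2)) ?leq_sqr.
apply: ereal_sup_ubound; exists (kraus_map (@label_mx R)).
  apply: free_extreme; first exact: label_mx_free.
  exact/kraus_map_CPset/sum_label_mx.
by rewrite free_choi_rank //; exact: label_mx_free.
Qed.
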